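(* Let $L$ be a finite trim lattice and let $G$ be a group acting on $L$ by lattice automorphisms. Then $L^G=\{x\in L: gx=x\text{ for all }g\in G\}$, which is a sublattice of $L$, is a trim lattice.
   Context: All lattices are finite. An element $x$ of a lattice $L$ is left modular if for all $y<z$ in $L$, $(y\vee x)\wedge z=y\vee(x\wedge z)$. A join-irreducible is an element that is not the minimum $\hat0$ and cannot be written as the join of two strictly smaller elements; a meet-irreducible is an element that is not the maximum $\hat1$ and cannot be written as the meet of two strictly larger elements. A lattice is trim if, for some $n$, it has a maximal chain of $n+1$ left modular elements and has exactly $n$ join-irreducibles and exactly $n$ meet-irreducibles. *)

(* Defs.v *)
From HB Require Import structures.
From mathcomp Require Import all_boot all_order.
From mathcomp Require Import boolp.

Set Implicit Arguments.
Unset Strict Implicit.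
Unset Printing Implicit Defensive.

Import Order.LTheory.
Local Open Scope order_scope.

Section Trim.
Variables (d : Order.disp_t) (L : finTBLatticeType d).

Definition left_modular (x : L) : Prop :=
  forall y z : L, y < z -> (y `|` x) `&` z = y `|` (x `&` z).

Definition join_irreducible (x : L) : bool :=
  (x != \bot) && ~~ [exists y : L, exists z : L, [&& y < x, z < x & x == y `|` z]].

Definition meet_irreducible (x : L) : bool :=
  (x != \top) && ~~ [exists y : L, exists z : L, [&& x < y, x < z & x == y `&` z]].

Definition chain (C : {set L}) : bool :=
  [forall x in C, forall y in C, x >=< y].

Definition maximal_chain (C : {set L}) : bool := maxset chain C.

Definition trim : Prop :=
  exists n : nat,
    [/\ exists C : {set L},
          [/\ maximal_chain C, #|C| = n.+1 & {in C, forall x, left_modular x}],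
        #|[set x | join_irreducible x]| = n
      & #|[set x | meet_irreducible x]| = n].

Definition lattice_automorphism (f : L -> L) : Prop :=
  [/\ bijective f,
      {morph f : x y / x `&` y >-> x `&` y}
    & {morph f : x y / x `|` y >-> x `|` y}].

End Trim.

Arguments trim {d} L.

Definition sublattice (d : Order.disp_t) (L : finTBLatticeType d)
    (S : {set L}) : Prop :=
  meet_closed S /\ join_closed S.

Record lattice_action (d : Order.disp_t) (G : groupType)
    (L : finTBLatticeType d) := LatticeAction {
  act :> G -> L -> L;
  act1 : forall x, act 1%g x = x;
  actM : forall g h x, act (g * h)%g x = act g (act h x);
  act_automorphism : forall g, lattice_automorphism (act g)
}.

Section FixedLattice.
Variables (d : Order.disp_t) (G : groupType) (L : finTBLatticeType d).
Variable a : lattice_action G L.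

(* G may be infinite, so being fixed by G is decided classically. *)
Definition fixed_points : {set L} := [set x | `[< forall g, a g x = x >]].

Lemma fixed_pointsP (x : L) : reflect (forall g, a g x = x) (x \in fixed_points).
Proof. by rewrite inE; apply: asboolP. Qed.

Lemma fixed_meet_closed : meet_closed fixed_points.
Proof.
move=> x y /fixed_pointsP xP /fixed_pointsP yP; apply/fixed_pointsP => g.
by have [_ -> _] := act_automorphism a g; rewrite xP yP.
Qed.

Lemma fixed_join_closed : join_closed fixed_points.
Proof.
move=> x y /fixed_pointsP xP /fixed_pointsP yP; apply/fixed_pointsP => g.
by have [_ _ ->] := act_automorphism a g; rewrite xP yP.
Qed.

Lemma fixed_bot : \bot \in fixed_points.
Proof.
apply/fixed_pointsP => g; have [[f fK Kf] morphI _] := act_automorphism a g.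
by rewrite -[\bot in LHS](meet0x (f \bot)) morphI Kf meetx0.
Qed.

Lemma fixed_top : \top \in fixed_points.
Proof.
apply/fixed_pointsP => g; have [[f fK Kf] _ morphU] := act_automorphism a g.
by rewrite -[\top in LHS](join1x (f \top)) morphU Kf joinx1.
Qed.

(* L^G with the order and the lattice operations inherited from L. *)
Definition fixed_lattice : Type := {x : L | x \in fixed_points}.

HB.instance Definition _ := SubFinite.on fixed_lattice.
HB.instance Definition _ := Order.SubChoice_isTBSubLattice.Build
  d L (mem fixed_points) d fixed_lattice
  fixed_meet_closed fixed_join_closed fixed_bot fixed_top.

End FixedLattice.

(* Main.v *)
(* Along a maximal chain of left modular elements of a trim lattice, each step i
   gains one join-irreducible j_i and loses one meet-irreducible m_i.  The spine,
   made of the x such that, for every i, j_i <= x or x <= m_i, consists of left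
   modular elements and is closed under joins.  It is stable under automorphisms,
   because it is the set of x above k and below n - k irreducibles, for some k.
   From a G-fixed x < 1 in the spine, take i minimal such that x does not contain
   j_i; the join y of the G-orbit of x \/ j_i is again a G-fixed spine element,
   and passing from x to y gains exactly the orbit of j_i and loses exactly the
   orbit of m_i.  Hence each such step gains one join-irreducible of L^G and loses
   one meet-irreducible of L^G. *)

Require Import Defs.
From mathcomp Require Import all_boot all_order.
From mathcomp Require Import boolp zify.

Set Implicit Arguments.
Unset Strict Implicit.
Unset Printing Implicit Defensive.

Import Order.Theory.
Local Open Scope order_scope.

(** * Irreducibles below and above an element *)

Section Irreducibles.
Variables (d : Order.disp_t) (L : finTBLatticeType d).
Implicit Types (x y : L) (C : {set L}).

Definition jis x : {set L} := [set j | join_irreducible j & j <= x].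
Definition mis x : {set L} := [set m | meet_irreducible m & x <= m].

(** Take [w] below [x], not below [y], with the fewest elements under it. If [w] were a join of two
    smaller elements, both would lie below [y] by minimality, and then so would [w]. *)
Lemma join_irreducible_sep x y :
  ~~ (x <= y) -> exists j, [/\ join_irreducible j, j <= x & ~~ (j <= y)].
Proof.
move=> xy; pose P (w : L) := (w <= x) && ~~ (w <= y).
have Px : P x by rewrite /P lexx.
case: (arg_minnP (fun w : L => #|[set v | v <= w]|) Px) => w /andP[wx wy] wmin.
exists w; split=> //; apply/andP; split.
  by apply: contraNneq wy => ->; rewrite le0x.
apply/negP => /existsP[a /existsP[b /and3P[aw bw /eqP wE]]].
have small c : c < w -> c <= y.
  move=> cw; apply: contraT => cy.
  have /wmin : P c by rewrite /P cy (le_trans (ltW cw) wx).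
  rewrite leqNgt => /negP[]; apply/proper_card/properP; split.
    by apply/subsetP => v; rewrite !inE => /le_trans; apply; apply: ltW.
  by exists w; rewrite !inE ?lexx ?(lt_geF cw).
by case/negP: wy; rewrite wE leUx !small.
Qed.

Lemma jis_sub x y : (jis x \subset jis y) = (x <= y).
Proof.
apply/idP/idP => [/subsetP sxy|xy].
  apply: contraT => /join_irreducible_sep[j [jj jx jy]].
  by have := sxy j; rewrite !inE jj jx (negPf jy) => /(_ isT).
apply/subsetP => j; rewrite !inE => /andP[-> /=] jx; exact: le_trans xy.
Qed.

Lemma jis_proper x y : (jis x \proper jis y) = (x < y).
Proof. by rewrite properE !jis_sub lt_leAnge. Qed.

Lemma jis0 : jis \bot = set0.
Proof.
apply/setP => j; rewrite !inE lex0.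
by apply/negP => /andP[/andP[/negP jb _] /jb].
Qed.

Lemma jis1 : jis \top = [set j | join_irreducible j].
Proof. by apply/setP => j; rewrite !inE lex1 andbT. Qed.

Lemma chain_jis_inj C : chain C -> {in C &, injective (fun x => #|jis x|)}.
Proof.
move=> /forall_inP chC x y xC yC /= e.
have /forall_inP/(_ y yC)/orP[] := chC x xC; rewrite -jis_sub => s.
  apply/le_anti; rewrite -!jis_sub s.
  by have /eqP -> : jis x == jis y; rewrite ?eqEcard ?s ?e ?leqnn ?subxx.
apply/le_anti; rewrite -!jis_sub s andbT.
by have /eqP -> : jis y == jis x; rewrite ?eqEcard ?s ?e ?leqnn ?subxx.
Qed.

Lemma chain_card C :
  chain C -> (#|C| <= #|[set j : L | join_irreducible j]|.+1)%N.
Proof.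
move=> chC; set n := #|[set j : L | _]|.
have jn x : (#|jis x| < n.+1)%N.
  by rewrite ltnS /n -jis1 subset_leq_card ?jis_sub ?lex1.
pose f x : 'I_n.+1 := inord #|jis x|.
have fI : {in C &, injective f}.
  move=> x y xC yC /(congr1 val); rewrite /= !inordK // => e.
  exact: (chain_jis_inj chC xC yC e).
by rewrite -(card_in_imset fI) -[leqRHS]card_ord max_card.
Qed.

(** Pigeonhole: [#|jis x|] is injective on the chain and has only the values 0 to [n], so [n.+1]
    chain elements exhaust them. *)
Lemma chain_full C n :
    chain C -> #|C| = n.+1 -> #|[set j : L | join_irreducible j]| = n ->
  forall i, (i <= n)%N -> exists2 x, x \in C & #|jis x| = i.
Proof.
move=> chC Cn Jn i ilen.
have jn x : (#|jis x| < n.+1)%N.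
  by rewrite ltnS -Jn -jis1 subset_leq_card ?jis_sub ?lex1.
pose f x : 'I_n.+1 := inord #|jis x|.
have /eqP fC : f @: C == setT.
  rewrite eqEcard subsetT cardsT card_ord card_in_imset ?Cn ?leqnn //.
  move=> x y xC yC /(congr1 val); rewrite /= !inordK // => e.
  exact: (chain_jis_inj chC xC yC e).
have : inord i \in f @: C by rewrite fC inE.
case/imsetP => x xC /(congr1 val); rewrite /= !inordK // => ->.
by exists x.
Qed.

End Irreducibles.

Section DualIrreducibles.
Variables (d : Order.disp_t) (L : finTBLatticeType d).
Implicit Types x y : L.

Lemma meet_irreducible_sep x y :
  ~~ (x <= y) -> exists m, [/\ meet_irreducible m, y <= m & ~~ (x <= m)].
Proof. exact: (@join_irreducible_sep _ L^d). Qed.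

Lemma mis_sub x y : (mis y \subset mis x) = (x <= y).
Proof. exact: (@jis_sub _ L^d). Qed.

Lemma mis_proper x y : (mis y \proper mis x) = (x < y).
Proof. exact: (@jis_proper _ L^d). Qed.

Lemma mis1 : mis (\top : L) = set0.
Proof. exact: (@jis0 _ L^d). Qed.

Lemma mis0 : mis (\bot : L) = [set m | meet_irreducible m].
Proof. exact: (@jis1 _ L^d). Qed.

End DualIrreducibles.

(** * Labelling of a trim lattice *)

(* For a trim lattice, [j i] (resp. [m i]) is the join-irreducible that appears
   (resp. the meet-irreducible that disappears) at the [i]-th step of a maximal
   chain of left modular elements. *)
Record labelling d (L : finTBLatticeType d) n (j m : 'I_n -> L) : Prop := {
  label_j : [set x | join_irreducible x] = [set j i | i : 'I_n];
  label_m : [set x | meet_irreducible x] = [set m i | i : 'I_n];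
  label_j_inj : injective j;
  label_m_inj : injective m;
  label_nle : forall i, ~~ (j i <= m i);
  label_le : forall i k : 'I_n, (i < k)%N -> j i <= m k;
  label_sep : forall y z, y < z ->
    exists i, [/\ j i <= z, ~~ (j i <= y), y <= m i & ~~ (z <= m i)]
}.

Lemma card1_step (T : finType) (A B : {set T}) n :
  A \subset B -> #|A| = n -> #|B| = n.+1 -> exists b, B :\: A = [set b].
Proof.
move=> AB An Bn; apply/cards1P.
by rewrite cardsD (setIidPr AB) An Bn subSnn.
Qed.

(** There is no slack: each of the [n] steps drops by at least one, from a start of at most [n], and
    the values cannot go below 0. *)
Lemma decreasing_nat_eq (f : nat -> nat) n :
    (f 0%N <= n)%N -> (forall i, (i < n)%N -> (f i.+1 < f i)%N) ->
  forall i, (i <= n)%N -> f i = (n - i)%N.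
Proof.
move=> f0 fS i ilen; apply/eqP; rewrite eqn_leq; apply/andP; split.
  elim: i ilen => [|i IH] ilen; first by rewrite subn0.
  have := fS i ilen; have := IH (ltnW ilen); lia.
have low k : (k <= n)%N -> (k <= f (n - k))%N.
  elim: k => // k IH kn; have := fS (n - k.+1)%N; have := IH (ltnW kn).
  have -> : ((n - k.+1).+1 = n - k)%N by lia.
  lia.
by have := low (n - i)%N (leq_subr _ _); rewrite subKn.
Qed.

Lemma trim_labelling d (L : finTBLatticeType d) :
  trim L -> exists n (j m : 'I_n -> L), labelling j m.
Proof.
case=> n [[C [maxC Cn lmC]] Jn Mn]; exists n.
have chC : chain C by have /maxsetP[] := maxC.
have ex (i : 'I_n.+1) : exists2 x, x \in C & #|jis x| = i.
  exact: (chain_full chC Cn Jn (ltn_ord i)).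
have [x' xC' xcard'] := fin_all_exists2 ex.
pose x i := x' (inord i).
have xC i : x i \in C by exact: xC'.
have xcard i : (i <= n)%N -> #|jis (x i)| = i by move=> ilen; rewrite xcard' inordK.
have xle i k : (i <= k)%N -> (k <= n)%N -> x i <= x k.
  move=> ik kn; have /orP[//|] := forall_inP (forall_inP chC _ (xC i)) _ (xC k).
  rewrite -jis_sub => /subset_leq_card; rewrite !xcard ?(leq_trans ik) // => ki.
  by have -> : i = k by apply/eqP; rewrite eqn_leq ik ki.
have xlt i : (i < n)%N -> x i < x i.+1.
  move=> ilt; rewrite lt_leAnge xle //= -jis_sub.
  by apply/negP => /subset_leq_card; rewrite !xcard ?ltnn // ltnW.
have ycard i : (i <= n)%N -> #|mis (x i)| = (n - i)%N.
  apply: (decreasing_nat_eq (f := fun i => #|mis (x i)|)) => [|k kn].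
    by rewrite -Mn -mis0 subset_leq_card ?mis_sub ?le0x.
  by apply: proper_card; rewrite mis_proper xlt.
have exj (i : 'I_n) : exists j, jis (x i.+1) :\: jis (x i) = [set j].
  apply: (@card1_step _ _ _ i); rewrite ?jis_sub ?xcard ?(ltW (xlt _ _)) //.
  exact: ltnW.
have exm (i : 'I_n) : exists m, mis (x i) :\: mis (x i.+1) = [set m].
  apply: (@card1_step _ _ _ (n - i.+1));
    rewrite ?mis_sub ?ycard ?(ltW (xlt _ _)) //.
    by rewrite subnSK.
  exact: ltnW.
have [j jE] := fin_all_exists exj.
have [m mE] := fin_all_exists exm.
have jP (i : 'I_n) v : [&& join_irreducible v, v <= x i.+1 & ~~ (v <= x i)] = (v == j i).
  rewrite -in_set1 -jE !inE; case: (join_irreducible v) => //=; exact: andbC.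
have mP (i : 'I_n) v : [&& meet_irreducible v, x i <= v & ~~ (x i.+1 <= v)] = (v == m i).
  rewrite -in_set1 -mE !inE; case: (meet_irreducible v) => //=; exact: andbC.
have [jI jle jnle] : [/\ forall i, join_irreducible (j i),
    forall i : 'I_n, j i <= x i.+1 & forall i : 'I_n, ~~ (j i <= x i)].
  by split=> i; have := jP i (j i); rewrite eqxx => /and3P[].
have [mI mle mnle] : [/\ forall i, meet_irreducible (m i),
    forall i : 'I_n, x i <= m i & forall i : 'I_n, ~~ (x i.+1 <= m i)].
  by split=> i; have := mP i (m i); rewrite eqxx => /and3P[].
have j_le (i k : 'I_n) : (i < k)%N -> j i <= x k.
  by move=> ik; apply: le_trans (jle i) (xle _ _ ik (ltnW (ltn_ord k))).
have m_ge (i k : 'I_n) : (i < k)%N -> x i.+1 <= m k.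
  by move=> ik; apply: le_trans (xle _ _ ik (ltnW (ltn_ord k))) (mle k).
have jinj : injective j.
  move=> i k e; apply/val_inj/eqP; case: ltngtP => // ik.
    by have := j_le _ _ ik; rewrite e (negPf (jnle k)).
  by have := j_le _ _ ik; rewrite -e (negPf (jnle i)).
have minj : injective m.
  move=> i k e; apply/val_inj/eqP; case: ltngtP => // ik.
    by have := m_ge _ _ ik; rewrite -e (negPf (mnle i)).
  by have := m_ge _ _ ik; rewrite e (negPf (mnle k)).
exists j, m; split=> //.
- apply/esym/eqP; rewrite eqEcard Jn card_imset // card_ord leqnn andbT.
  by apply/subsetP => _ /imsetP[i _ ->]; rewrite inE.
- apply/esym/eqP; rewrite eqEcard Mn card_imset // card_ord leqnn andbT.
  by apply/subsetP => _ /imsetP[i _ ->]; rewrite inE.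
(* Every join-irreducible below [x i.+1] other than [j i] is below [x i], hence below [m i]; so
   [j i <= m i] would give [x i.+1 <= m i]. *)
- move=> i; apply: contra (mnle i) => jm; rewrite -jis_sub.
  apply/subsetP => v; rewrite !inE => /andP[vJ vx]; rewrite vJ /=.
  have [vx'|nvx] := boolP (v <= x i); first exact: le_trans vx' (mle i).
  by have /eqP -> : v == j i by rewrite -jP vJ vx nvx.
- by move=> i k ik; apply: le_trans (j_le _ _ ik) (mle k).
move=> y z yz.
have xn : x n = \top.
  apply/eqP; rewrite -le1x -jis_sub jis1.
  have /eqP <- : jis (x n) == [set v | join_irreducible v]; last exact: subxx.
  by rewrite eqEcard Jn xcard // leqnn andbT -jis1 jis_sub lex1.
have x0 : x 0%N = \bot.
  apply/eqP; rewrite -lex0 -jis_sub.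
  by have /eqP := xcard 0%N isT; rewrite cards_eq0 => /eqP ->; exact: sub0set.
(* The separating index is the step [k] at which [y] joined with the chain first gets above [z]. *)
have exi : exists i, z <= y `|` x i by exists n; rewrite xn joinx1 lex1.
case: (ex_minnP exi) => -[|k] zk kmin.
  by move: zk; rewrite x0 joinx0 (lt_geF yz).
have kn : (k < n)%N by apply: kmin; rewrite xn joinx1 lex1.
have nzk : ~~ (z <= y `|` x k) by apply/negP => /kmin; rewrite ltnn.
pose i := Ordinal kn; exists i.
(* Otherwise left modularity of [x k.+1] gives z = (y ∨ x_{k+1}) ∧ z = y ∨ (x_{k+1} ∧ z) ≤ y ∨ (x_k
   ∧ z) ≤ y ∨ x_k, against the choice of [k]. *)
have [v [vJ vl vn]] : exists v, [/\ join_irreducible v, v <= x k.+1 `&` z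
    & ~~ (v <= y `|` (x k `&` z))].
  apply: join_irreducible_sep; apply/negP => le1.
  case/negP: nzk; apply: le_trans (leU2 (lexx y) (leIl (x k) z)).
  rewrite -{1}(meet_idPr zk) (lmC _ (xC k.+1)) // leUx leUl /=; exact: le1.
have [w [wM wl wn]] := meet_irreducible_sep nzk.
move: vl vn; rewrite lexI => /andP[vx vz] vn.
have [nvy nvx] : ~~ (v <= y) /\ ~~ (v <= x k).
  split; apply: contra vn => h; first exact: lexUl.
  by apply: lexUr; rewrite lexI h.
have /eqP <- : v == j i by rewrite -jP vJ vx nvx.
move: wl; rewrite leUx => /andP[yw xw].
have /eqP <- : w == m i; last by split.
(* If [w] were above [x k.+1], it would be above y ∨ x_{k+1}, hence above [z]. *)
rewrite -mP wM xw /=; apply: contra wn => xw'.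
by apply: le_trans zk _; rewrite leUx yw.
Qed.

(** * The spine *)

Section Spine.
Variables (d : Order.disp_t) (L : finTBLatticeType d) (n : nat).
Variables j m : 'I_n -> L.
Implicit Types x y : L.

Definition spine x : bool := [forall i, (j i <= x) || (x <= m i)].

Hypothesis jm : labelling j m.

(** The index sets of j_i ≤ x and of x ≤ m_i are disjoint by [label_nle], so they cover all indices
    exactly when their sizes add up to [n]. This form does not mention the labels, which makes it
    invariant under automorphisms. *)
Lemma spine_card x : spine x = (#|jis x| + #|mis x| == n)%N.
Proof.
have jisE : #|jis x| = #|[set i | j i <= x]|.
  rewrite -(card_imset _ (label_j_inj jm)); apply: eq_card => v.
  have jJ : join_irreducible v = (v \in [set j i | i : 'I_n]).
    by rewrite -(label_j jm) inE.
  rewrite inE jJ.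
  apply/andP/imsetP => [[/imsetP[i _ ->] ix]|[i]]; first by exists i; rewrite ?inE.
  by rewrite inE => ix ->; split=> //; apply: imset_f.
have misE : #|mis x| = #|[set i | x <= m i]|.
  rewrite -(card_imset _ (label_m_inj jm)); apply: eq_card => v.
  have mM : meet_irreducible v = (v \in [set m i | i : 'I_n]).
    by rewrite -(label_m jm) inE.
  rewrite inE mM.
  apply/andP/imsetP => [[/imsetP[i _ ->] ix]|[i]]; first by exists i; rewrite ?inE.
  by rewrite inE => ix ->; split=> //; apply: imset_f.
rewrite jisE misE -cardsUI.
have -> : [set i | j i <= x] :&: [set i | x <= m i] = set0.
  apply/setP => i; rewrite !inE; apply/negP => /andP[jx xm].
  by case/negP: (label_nle jm i); apply: le_trans xm.
rewrite cards0 addn0; set U := _ :|: _.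
have -> : (#|U| == n) = (U == setT).
  rewrite eqEcard subsetT cardsT card_ord eqn_leq.
  by rewrite -[X in (_ <= X)%N]card_ord max_card.
rewrite -subTset; apply/forallP/subsetP => [s i _|s i]; first by rewrite !inE.
by have := s i; rewrite !inE => /(_ isT).
Qed.

(** If the modular inequality were strict, [label_sep] would separate its sides by some [i]. But j_i
    ≤ x puts j_i below x ∧ z, and x ≤ m_i puts y ∨ x below m_i. *)
Lemma spine_left_modular x : spine x -> left_modular x.
Proof.
move=> /forallP sx y z yz; apply/esym/eqP.
have le : y `|` (x `&` z) <= (y `|` x) `&` z.
  by rewrite leUx !lexI leUl (ltW yz) leIr (lexUr _ (leIl _ _)).
apply: contraT => ne.
have /(label_sep jm)[i [jl jn lm nlm]] : y `|` (x `&` z) < (y `|` x) `&` z.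
  by rewrite lt_neqAle ne.
move: jl; rewrite lexI => /andP[_ jz]; move: lm; rewrite leUx => /andP[ym _].
have /orP[jx|xm] := sx i; first by case/negP: jn; apply: lexUr; rewrite lexI jx.
by case/negP: nlm; apply: leIxl; rewrite leUx ym.
Qed.

Lemma spine0 : spine \bot.
Proof. by apply/forallP => i; rewrite le0x orbT. Qed.

(** If no member of [W] is above [j i], the spine condition puts all of them, hence their join,
    below [m i]. *)
Lemma spine_join_nle (W : pred L) i :
    (forall w, W w -> spine w) -> ~~ (\join_(w | W w) w <= m i) ->
  exists2 w, W w & j i <= w.
Proof.
move=> sW nle; apply: contrapT => no; case/negP: nle; apply/joinsP => w Ww.
have /forallP/(_ i)/orP[jw|//] := sW w Ww.
by case: no; exists w.
Qed.

Lemma spine_join_le (W : pred L) i :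
    (forall w, W w -> spine w) -> j i <= \join_(w | W w) w ->
  exists2 w, W w & j i <= w.
Proof.
move=> sW jW; apply: spine_join_nle => //.
by apply: contra (label_nle jm i); apply: le_trans.
Qed.

Lemma spine_joins (W : pred L) :
  (forall w, W w -> spine w) -> spine (\join_(w | W w) w).
Proof.
move=> sW; apply/forallP => i; apply/orP.
have [|nle] := boolP (\join_(w | W w) w <= m i); [by right|left].
by have [w Ww jw] := spine_join_nle sW nle; apply: joins_min Ww jw.
Qed.

Lemma spine_next x : spine x -> x != \top ->
  exists i, [/\ ~~ (j i <= x), spine (x `|` j i),
    forall k, j k <= x `|` j i -> ~~ (j k <= x) -> k = i &
    forall k, x <= m k -> ~~ (x `|` j i <= m k) -> k = i].
Proof.
move=> sx; rewrite -ltx1 => /(label_sep jm)[i0 [_ i0P _ _]].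
(* With [i] least, every other missing index [k] exceeds [i], so [label_le] gives j_i ≤ m_k and
   adding [j i] leaves the status of [k] unchanged. *)
case: (arg_minnP (P := fun i => ~~ (j i <= x)) (@nat_of_ord n) i0P) => i jix imin.
have xm k : ~~ (j k <= x) -> x <= m k.
  by have /forallP/(_ k)/orP[->|] := sx.
have above (k : 'I_n) : (i < k)%N -> ~~ (j k <= x) -> x `|` j i <= m k.
  by move=> ik kx; rewrite leUx xm // (label_le jm).
have up k : ~~ (j k <= x) -> k != i -> x `|` j i <= m k.
  move=> kx ki; apply: above => //; rewrite ltn_neqAle imin // andbT.
  by rewrite eq_sym.
exists i; split=> //.
- apply/forallP => k; have [->|ki] := eqVneq k i; first by rewrite leUr.
  have [jk|kx] := boolP (j k <= x); first by rewrite lexUl.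
  by rewrite up ?orbT.
- move=> k jk kx; apply/eqP; apply: contraT => ki.
  by case/negP: (label_nle jm k); apply: le_trans jk (up _ kx ki).
- move=> k xk nk; apply/eqP; apply: contraT => ki; case/negP: nk.
  apply: up => //; apply: contra (label_nle jm k) => jk.
  exact: le_trans jk xk.
Qed.

End Spine.

(** * Invariance of irreducibles under automorphisms *)

Section Automorphisms.

Lemma automorphism_le d (L : finTBLatticeType d) (f : L -> L) :
  lattice_automorphism f -> {mono f : x y / x <= y}.
Proof.
by move=> [fb fI _] x y; rewrite !leEmeet -fI (inj_eq (bij_inj fb)).
Qed.

Lemma automorphism_dual d (L : finTBLatticeType d) (f : L -> L) :
  lattice_automorphism f -> @lattice_automorphism _ L^d f.
Proof. by case=> fb fI fU; split. Qed.

Lemma automorphism_join_irreducible d (L : finTBLatticeType d) (f : L -> L) x :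
  lattice_automorphism f -> join_irreducible (f x) = join_irreducible x.
Proof.
move=> fA; have fle := automorphism_le fA; have [fb _ fU] := fA.
have fi := bij_inj fb; have flt := leW_mono fle; have [h fK hK] := fb.
have f0 : f \bot = \bot by apply/eqP; rewrite -lex0 -[leRHS]hK fle le0x.
congr (_ && ~~ _); first by rewrite -{1}f0 (inj_eq fi).
apply/existsP/existsP => -[y /existsP[z /and3P[yx zx /eqP e]]].
  exists (h y); apply/existsP; exists (h z).
  by rewrite -(flt (h y)) -(flt (h z)) !hK yx zx -(inj_eq fi) fU !hK e eqxx.
by exists (f y); apply/existsP; exists (f z); rewrite !flt yx zx e fU eqxx.
Qed.

Lemma automorphism_meet_irreducible d (L : finTBLatticeType d) (f : L -> L) x :
  lattice_automorphism f -> meet_irreducible (f x) = meet_irreducible x.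
Proof. by move=> /automorphism_dual; apply: automorphism_join_irreducible. Qed.

Lemma automorphism_card_jis d (L : finTBLatticeType d) (f : L -> L) x :
  lattice_automorphism f -> #|jis (f x)| = #|jis x|.
Proof.
move=> fA; have [fb _ _] := fA.
rewrite -(on_card_preimset (onW_bij _ fb)); apply: eq_card => v.
by rewrite !inE automorphism_join_irreducible // automorphism_le.
Qed.

Lemma automorphism_card_mis d (L : finTBLatticeType d) (f : L -> L) x :
  lattice_automorphism f -> #|mis (f x)| = #|mis x|.
Proof. by move=> /automorphism_dual; apply: automorphism_card_jis. Qed.

End Automorphisms.

(** * Counting irreducibles and a criterion for trimness *)

(* The hypothesis on [j], [j'] says that all join-irreducibles of [L] entering
   between [f c] and [f c'] have the same closure [q] in [K]; then [q] is the only
   join-irreducible of [K] that can enter between [c] and [c']. *)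
Lemma card_jis_step dK dL (K : finTBLatticeType dK) (L : finTBLatticeType dL)
    (f : K -> L) (c c' : K) :
    {mono f : x y / x <= y} -> {morph f : x y / x `&` y} -> f \top = \top ->
    c < c' ->
    (forall j j', join_irreducible j -> j <= f c' -> ~~ (j <= f c) ->
       join_irreducible j' -> j' <= f c' -> ~~ (j' <= f c) ->
       forall p, j <= f p -> j' <= f p) ->
  #|jis c'| = #|jis c|.+1.
Proof.
move=> fle fI f1 cc' same.
have [j [jJ jc' jc]] : exists j,
    [/\ join_irreducible j, j <= f c' & ~~ (j <= f c)].
  by apply: join_irreducible_sep; rewrite fle (lt_geF cc').
pose q := \meet_(p | j <= f p) p.
have jq : j <= f q.
  by apply: (big_ind (fun p => j <= f p)) => [|x y jx jy|//];
    rewrite ?f1 ?lex1 ?fI ?lexI ?jx.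
have stepE : jis c' :\: jis c \subset [set q].
  apply/subsetP => p; rewrite !inE => /andP[/nandP npc /andP[pJ pc']].
  have pc : ~~ (p <= c) by case: npc => //; rewrite pJ.
  have [v [vJ vp vc]] : exists v,
      [/\ join_irreducible v, v <= f p & ~~ (v <= f c)].
    by apply: join_irreducible_sep; rewrite fle.
  have vc' : v <= f c' by apply: le_trans vp _; rewrite fle.
  have qp : q <= p by apply: meets_inf; apply: (same v j).
  (* If [p] differs from [q], then p = (p ∧ c) ∨ q with both terms smaller: a join-irreducible of
     [L] below [f p] is either below [f c], hence below f(p ∧ c), or new, hence below [f q]. *)
  apply: contraT => pq; have /andP[_ /negP[]] := pJ.
  apply/existsP; exists (p `&` c); apply/existsP; exists q.
  rewrite !lt_neqAle leIl qp [q == p]eq_sym pq !andbT; apply/andP; split.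
    by apply: contra pc => /eqP <-; apply: leIr.
  rewrite eq_le leUx leIl qp /= ?andbT -fle.
  apply: contraT => /join_irreducible_sep[w [wJ wp wn]].
  case/negP: wn; have [wc|nwc] := boolP (w <= f c).
    have : w <= f (p `&` c) by rewrite fI lexI wp.
    by move/le_trans; apply; rewrite fle leUl.
  have wc' : w <= f c' by apply: le_trans wp _; rewrite fle.
  have : w <= f q by apply: (same j w).
  by move/le_trans; apply; rewrite fle leUr.
have prop : jis c \proper jis c' by rewrite jis_proper.
apply/eqP; rewrite eqn_leq (proper_card prop) andbT.
rewrite -(cardsID (jis c)) (setIidPr (proper_sub prop)) -addn1 leq_add2l.
by rewrite -(cards1 q) subset_leq_card.
Qed.

Lemma card_mis_step dK dL (K : finTBLatticeType dK) (L : finTBLatticeType dL)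
    (f : K -> L) (c c' : K) :
    {mono f : x y / x <= y} -> {morph f : x y / x `|` y} -> f \bot = \bot ->
    c < c' ->
    (forall m m', meet_irreducible m -> f c <= m -> ~~ (f c' <= m) ->
       meet_irreducible m' -> f c <= m' -> ~~ (f c' <= m') ->
       forall p, f p <= m -> f p <= m') ->
  #|mis c| = #|mis c'|.+1.
Proof.
move=> fle fU f0 cc'.
by apply: (@card_jis_step _ _ K^d L^d f c' c) => // x y; apply: fle.
Qed.

(** Climbing from the bottom, [#|mis x|] counts the steps left before the top, and each step adds
    one join-irreducible, so both kinds are as numerous as the steps. By [chain_card] no chain is
    longer, whence maximality. *)
Lemma trim_of_steps d (K : finTBLatticeType d) (P : pred K) :
    P \bot ->
    (forall x, P x -> x != \top -> exists y, [/\ P y, x < y,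
       #|jis y| = #|jis x|.+1 & #|mis x| = #|mis y|.+1]) ->
    (forall x, P x -> left_modular x) ->
  trim K.
Proof.
move=> P0 next Plm.
have climb n x : P x -> #|mis x| = n -> exists C : {set K},
    [/\ chain C, {in C, forall y, P y}, {in C, forall y, x <= y},
        #|C| = n.+1 & #|[set j : K | join_irreducible j]| = (#|jis x| + n)%N].
  elim: n x => [|n IH] x Px xn.
    have x1 : x = \top.
      apply/eqP; rewrite -le1x -mis_sub; move/eqP: xn.
      by rewrite cards_eq0 => /eqP ->; apply: sub0set.
    rewrite {}x1 {xn} in Px *.
    exists [set \top]; split.
    - apply/forall_inP => y /set1P ->; apply/forall_inP => z /set1P ->.
      exact: comparablexx.
    - by move=> y /set1P ->.
    - by move=> y /set1P ->.
    - by rewrite cards1.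
    - by rewrite jis1 addn0.
  have x1 : x != \top by apply: contra_eq_neq xn => ->; rewrite mis1 cards0.
  have [y [Py xy yJ yM]] := next x Px x1.
  have /(IH y Py)[C [chC PC yC Cn Jn]] : #|mis y| = n by move: yM; rewrite xn => -[].
  have xC z : z \in C -> x < z by move=> /yC; apply: lt_le_trans.
  exists (x |: C); split.
  - apply/forall_inP => u /setU1P[->|uC]; apply/forall_inP => v /setU1P[->|vC].
    + exact: comparablexx.
    + by rewrite /Order.comparable (ltW (xC _ vC)).
    + by rewrite /Order.comparable (ltW (xC _ uC)) orbT.
    + exact: (forall_inP (forall_inP chC _ uC) _ vC).
  - by move=> z /setU1P[->|/PC].
  - by move=> z /setU1P[->|/xC/ltW].
  - rewrite cardsU1 Cn; have -> // : x \notin C.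
    by apply/negP => /xC; rewrite ltxx.
  - by rewrite Jn yJ addSnnS.
have [C [chC PC _ Cn]] := climb _ \bot P0 erefl.
rewrite mis0 jis0 cards0 add0n in Cn * => Jn.
exists #|[set m : K | meet_irreducible m]|; split=> //.
exists C; split=> //; last by move=> x /PC/Plm.
apply/maxsetP; split=> // D chD CD; apply/esym/eqP.
by rewrite eqEcard CD Cn -Jn chain_card.
Qed.

(** * Fixed points in the spine *)

Section FixedSpine.
Variables (d : Order.disp_t) (L : finTBLatticeType d) (G : groupType).
Variables (a : lattice_action G L) (n : nat) (j m : 'I_n -> L).
Hypothesis jm : labelling j m.

Let K : finTBLatticeType d := fixed_lattice a.

Lemma act_le g : {mono a g : x y / x <= y}.
Proof. exact/automorphism_le/act_automorphism. Qed.

Lemma act_leV g x y : (x <= a g y) = (a g^-1%g x <= y).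
Proof. by rewrite -[in RHS](act_le g) -actM mulgV act1. Qed.

Lemma act_geV g x y : (a g x <= y) = (x <= a g^-1%g y).
Proof. by rewrite -[in RHS](act_le g) -actM mulgV act1. Qed.

Lemma act_fixed g (p : K) : a g (val p) = val p.
Proof. exact: (fixed_pointsP a _ (valP p)). Qed.

Lemma spine_act g x : spine j m x -> spine j m (a g x).
Proof.
have aA := act_automorphism a g.
by rewrite !(spine_card jm) automorphism_card_jis // automorphism_card_mis.
Qed.

(** Each [a h] permutes the orbit, so it sends the join below itself; applying this to the inverse
    of [h] gives equality. *)
Lemma orbit_join_fixed (z : L) :
  \join_(w | `[< exists g, w = a g z >]) w \in fixed_points a.
Proof.
set y := \join_(w | _) w.
have le h : a h y <= y.
  rewrite act_geV; apply/joinsP => _ /asboolP[g ->].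
  rewrite act_leV invgK -actM.
  by have /joinsP := lexx y; apply; apply/asboolP; exists (h * g)%g.
apply/fixed_pointsP => h; apply/le_anti; rewrite le /=.
by rewrite act_leV le.
Qed.

Lemma fixed_spine_next (c : K) : spine j m (val c) -> c != \top ->
  exists y : K, [/\ spine j m (val y), c < y,
    #|jis y| = #|jis c|.+1 & #|mis c| = #|mis y|.+1].
Proof.
move=> sc c1; have vc1 : val c != \top by [].
have [i [jic sz jz mz]] := spine_next jm sc vc1; set z := val c `|` j i in sz jz mz.
pose W w := `[< exists g, w = a g z >].
have sW w : W w -> spine j m w by case/asboolP=> g ->; apply: spine_act.
pose y : K := exist (fun x => x \in fixed_points a) _ (orbit_join_fixed z).
have zy : z <= val y.
  have /joinsP := lexx (val y); apply; apply/asboolP.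
  by exists 1%g; rewrite act1.
have cy : c < y.
  rewrite lt_leAnge; apply/andP; split; first exact: le_trans (leUl _ _) zy.
  by apply: contra jic; apply: (le_trans (le_trans (leUr _ _) zy)).
(* By [spine_join_le], [v] is already below some translate [a g z]. Moving back by the inverse of
   [g] fixes [c] and gives a label entering between [c] and [z], which can only be [j i]. *)
have jP v : join_irreducible v -> v <= val y -> ~~ (v <= val c) ->
    exists g, v = a g (j i).
  move=> vJ vy vc.
  have /imsetP[k _ vE] : v \in [set j i | i : 'I_n] by rewrite -(label_j jm) inE.
  have [_ /asboolP[g ->]] : exists2 w, W w & j k <= w.
    by apply: (spine_join_le jm sW); rewrite -vE.
  rewrite -vE act_leV => vz; exists g.
  have aA := act_automorphism a g^-1%g.
  have /imsetP[l _ lE] : a g^-1%g v \in [set j i | i : 'I_n].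
    by rewrite -(label_j jm) inE automorphism_join_irreducible.
  rewrite -(jz l) -?lE -?actM ?mulgV ?act1 //.
  by rewrite -act_leV act_fixed.
have mP v : meet_irreducible v -> val c <= v -> ~~ (val y <= v) ->
    exists g, v = a g (m i).
  move=> vM cv yv.
  have [g zv] : exists g, ~~ (a g z <= v).
    apply: contrapT => no; case/negP: yv; apply/joinsP => _ /asboolP[g ->].
    by apply: contraT => zv; case: no; exists g.
  rewrite act_geV in zv; exists g.
  have aA := act_automorphism a g^-1%g.
  have /imsetP[l _ lE] : a g^-1%g v \in [set m i | i : 'I_n].
    by rewrite -(label_m jm) inE automorphism_meet_irreducible.
  rewrite -(mz l) -?lE -?actM ?mulgV ?act1 //.
  by rewrite -act_geV act_fixed.
exists y; split=> //.
- exact: spine_joins sW.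
- apply: (@card_jis_step _ _ K L val c y) => //.
  move=> v v' vJ vy vc vJ' vy' vc' p.
  have [g ->] := jP v vJ vy vc; have [g' ->] := jP v' vJ' vy' vc'.
  (* Since [p] is fixed, it is above one element of the orbit of [j i] exactly when it is above
     [j i]. *)
  by rewrite !act_geV !act_fixed.
- apply: (@card_mis_step _ _ K L val c y) => //.
  move=> v v' vM vy vc vM' vy' vc' p.
  have [g ->] := mP v vM vy vc; have [g' ->] := mP v' vM' vy' vc'.
  by rewrite !act_leV !act_fixed.
Qed.

Lemma fixed_spine_left_modular (x : K) : spine j m (val x) -> left_modular x.
Proof.
by move=> sx y z yz; apply/val_inj; apply: (spine_left_modular jm sx).
Qed.

End FixedSpine.

Theorem theorem4 (d : Order.disp_t) (L : finTBLatticeType d) (G : groupType)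
    (a : lattice_action G L) :
  trim L -> sublattice (fixed_points a) /\ trim (fixed_lattice a).
Proof.
case/trim_labelling=> n [j [m jm]]; split.
  by split; [apply: fixed_meet_closed | apply: fixed_join_closed].
pose P (x : fixed_lattice a) := spine j m (val x).
apply: (@trim_of_steps _ _ P) => [|x|x].
- exact: spine0.
- exact: fixed_spine_next.
- exact: (fixed_spine_left_modular jm).
Qed.
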